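(* Let $S\subseteq(0,1)$ be open, $f:S\to(0,1)$ differentiable, and consider a (possibly randomized) Bernoulli factory for $f$ that is fast. Then for every $p\in S$, $$\mathbb E[N]\ \ge\ (f'(p))^2\,\frac{p(1-p)}{f(p)(1-f(p))}.$$
   Context: Let $X=(X_i)$ be i.i.d. Bernoulli with parameter $p\in S$ and $U=(U_i)$ i.i.d. uniform on $(0,1)$, independent of $X$. A (possibly randomized) Bernoulli factory for $f$ consists of measurable stopping functions $\tau_i(x_1,u_1;\dots;x_i,u_i)\in\{0,1\}$ and measurable output functions $\gamma_n(x_1,u_1;\dots;x_n,u_n)\in\{0,1\}$; $N=\min\{i:\tau_i(X_1,U_1;\dots;X_i,U_i)=1\}$ is assumed finite almost surely, and the output $Y=\gamma_N(X_1,U_1;\dots;X_N,U_N)$ satisfies $\Pr[Y=1]=f(p)$ for all $p\in S$. The factory is fast if for every $p\in S$ there exist $A>0$, $\beta<1$ with $\Pr[N>n]\le A\beta^n$ for all $n$. *)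

(* Defs.v *)
From HB Require Import structures.
From mathcomp Require Import all_boot all_order all_algebra.
From mathcomp Require Import all_classical all_reals all_analysis.

Set Implicit Arguments.
Unset Strict Implicit.
Unset Printing Implicit Defensive.

Import Order.TTheory GRing.Theory Num.Theory.
Import numFieldNormedType.Exports.

Local Open Scope classical_set_scope.
Local Open Scope ring_scope.

(** Conventions.
    A Bernoulli factory is given by measurable stopping functions and output
    functions.  We index them from 0:  [tau n] is the paper's tau_{n+1} and
    [gamma n] is the paper's gamma_{n+1}; both act on the (n+1)-tuple
    ((x_1,u_1);...;(x_{n+1},u_{n+1})) of observations, an element of the
    measurable space [n.+1.-tuple (bool * R)] (product sigma-algebra, with the
    Borel sigma-algebra on R and the discrete one on bool). *)

Section Factory.
Context {R : realType}.

Definition stopfun := forall n : nat, n.+1.-tuple (bool * R)%type -> bool.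

Definition obs {T : Type} (X : nat -> T -> bool) (U : nat -> T -> R)
  (n : nat) (t : T) : n.-tuple (bool * R)%type :=
  [tuple (X i t, U i t) | i < n].

Definition bern_mass (p : R) (A : set bool) : \bar R :=
  ((if `[< A true >] then p else 0) + (if `[< A false >] then 1 - p else 0))%:E.

(** [iid_setting P p X U]: on the probability space P, the X_i are i.i.d.
    Bernoulli(p), the U_i are i.i.d. uniform on (0,1), and the families X and
    U are independent; i.e. the pairs (X_i,U_i) are measurable and, for every
    n, the joint law of (X_0,U_0),...,(X_{n-1},U_{n-1}) is the product
    of Bernoulli(p) x Uniform(0,1). *)
Definition iid_setting {d} {T : measurableType d} (P : probability T R)
  (p : R) (X : nat -> T -> bool) (U : nat -> T -> R) : Prop :=
  (forall i, measurable_fun [set: T] (X i)) /\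
  (forall i, measurable_fun [set: T] (U i)) /\
  (forall (n : nat) (A : nat -> set bool) (B : nat -> set R),
     (forall i, measurable (B i)) ->
     P (\bigcap_(i in `I_n) (X i @^-1` A i `&` U i @^-1` B i)) =
     (\prod_(i < n) (bern_mass p (A i) *
                      lebesgue_measure (B i `&` `]0%R, 1%R[)))%E).

(** N is the first index (counting from 1) at which the stopping rule fires;
    +oo if it never fires. *)
Definition stop_time {T : Type} (tau : stopfun)
  (X : nat -> T -> bool) (U : nat -> T -> R) (t : T) : \bar R :=
  ereal_inf [set (n.+1)%:R%:E | n in [set n | tau n (obs X U n.+1 t)]].

Definition N_gt {T : Type} (tau : stopfun) (X : nat -> T -> bool)
  (U : nat -> T -> R) (n : nat) : set T :=
  [set t | forall k, (k < n)%N -> ~~ tau k (obs X U k.+1 t)].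

Definition N_finite {T : Type} (tau : stopfun) (X : nat -> T -> bool)
  (U : nat -> T -> R) : set T :=
  [set t | exists n, tau n (obs X U n.+1 t)].

Definition Y_one {T : Type} (tau gamma : stopfun) (X : nat -> T -> bool)
  (U : nat -> T -> R) : set T :=
  [set t | exists n, [/\ tau n (obs X U n.+1 t),
                        (forall k, (k < n)%N -> ~~ tau k (obs X U k.+1 t)) &
                        gamma n (obs X U n.+1 t)]].

Definition measurable_factory (tau gamma : stopfun) : Prop :=
  (forall n, measurable_fun [set: n.+1.-tuple (bool * R)%type] (tau n)) /\
  (forall n, measurable_fun [set: n.+1.-tuple (bool * R)%type] (gamma n)).

Definition bernoulli_factory (S : set R) (f : R -> R) (tau gamma : stopfun)
  : Prop :=
  measurable_factory tau gamma /\
  forall p, S p ->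
  forall d (T : measurableType d) (P : probability T R)
         (X : nat -> T -> bool) (U : nat -> T -> R),
    iid_setting P p X U ->
    P (N_finite tau X U) = 1%E /\ P (Y_one tau gamma X U) = (f p)%:E.

Definition fast_factory (S : set R) (tau : stopfun) : Prop :=
  forall p, S p ->
  forall d (T : measurableType d) (P : probability T R)
         (X : nat -> T -> bool) (U : nat -> T -> R),
    iid_setting P p X U ->
    exists A beta : R, 0 < A /\ beta < 1 /\
      forall n : nat, (P (N_gt tau X U n) <= (A * beta ^+ n)%:E)%E.

End Factory.

(* Main.v *)
(** The bound is a data-processing inequality for the Kullback-Leibler
    divergence between the laws of the stopped experiment at [p] and at a
    nearby [q].  By Wald's identity the divergence of the experiment is
    [E[N] * kl p q], and reading off only the output bit cannot increase it, so
    [kl (f p) (f q) <= E[N] * kl p q]; dividing by [(q - p)^2] and letting [q]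
    tend to [p] gives the claim.  Working with [kl] rather than with the score
    avoids differentiating under the expectation.  The experiment at [q] is realized on the probability space of the
    one at [p] by re-extracting bits and uniforms from the [U_i].  Expectations
    of log-likelihood ratios are finite sums over words [s] of bits, since the
    ratio depends on the observed bits only. *)

Require Import Defs.
From HB Require Import structures.
From mathcomp Require Import all_boot all_order all_algebra.
From mathcomp Require Import all_classical all_reals all_analysis.
From mathcomp Require Import measurable_realfun ring lra.

Set Implicit Arguments.
Unset Strict Implicit.
Unset Printing Implicit Defensive.

Import Order.TTheory GRing.Theory Num.Theory.
Import numFieldNormedType.Exports.

Local Open Scope classical_set_scope.
Local Open Scope ring_scope.

(** * Bounds on the binary divergence and their limit *)

(** The difference [g] of the two sides vanishes at 0 and has derivative [y ^+ 3 / (1 + y)], which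
    has the sign of [y]; the mean value theorem on either side of 0 gives [0 <= g x]. *)
Lemma ln1p_le_cubic {R : realType} (x : R) : -1 < x ->
  ln (1 + x) <= x - x ^+ 2 / 2 + x ^+ 3 / 3.
Proof.
move=> x_gtN1.
pose g (y : R) := y - y ^+ 2 / 2 + y ^+ 3 / 3 - ln (1 + y).
have gD (y : R) : -1 < y -> is_derive y 1 g (y ^+ 3 / (1 + y)).
  move=> y_gtN1; have y1_gt0 : 0 < 1 + y by lra.
  have dln : is_derive y 1 (fun z : R => ln (1 + z)) ((1 + y)^-1).
    rewrite -[X in is_derive _ _ _ X]mulr1.
    apply: (@is_derive1_comp R (@ln R) (fun z => 1 + z)).
      exact: is_derive1_ln.
    by apply: is_derive_eq; rewrite add0r mul1r.
  have dg := is_deriveB (is_deriveD (is_deriveB (is_derive_id y 1)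
    (is_deriveZ 2^-1 (is_deriveX 2 (is_derive_id y 1))))
    (is_deriveZ 3^-1 (is_deriveX 3 (is_derive_id y 1)))) dln.
  have -> : g = id - 2^-1 \*: id ^+ 2 + 3^-1 \*: id ^+ 3 - (fun z => ln (1 + z)).
    by apply/funext => z; rewrite /g !fctE /= !expr2 !exprS expr0 /GRing.scale/=; ring.
  apply: is_derive_eq dg _; rewrite /GRing.scale/=; field.
  by rewrite gt_eqF.
have g0 : g 0 = 0 by rewrite /g addr0 ln1 !expr0n /= !mul0r !subr0 addr0.
suff : 0 <= g x by rewrite /g subr_ge0.
have [x0|x0|->] := ltgtP x 0; last by rewrite g0.
- have [c||c /itvP c0 gE] := @MVT R g (fun y => y ^+ 3 / (1 + y)) x 0 x0.
  + by rewrite in_itv/= => /andP[xc _]; apply: gD; exact: lt_trans xc.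
  + apply: derivable_within_continuous => y; rewrite in_itv/= => /andP[xy _].
    by apply: (@ex_derive _ _ _ _ _ _ _ (gD y _)); exact: lt_le_trans xy.
  have xc : x < c by rewrite c0.
  have cN1 : 0 < 1 + c by lra.
  have c3 : c ^+ 3 <= 0.
    have cl : c < 0 by rewrite c0.
    by rewrite exprS mulr_le0_ge0 ?sqr_ge0 ?ltW.
  move: gE; rewrite g0 sub0r => /eqP; rewrite eqr_oppLR => /eqP ->.
  rewrite oppr_ge0 mulr_le0_ge0//; last by lra.
  by rewrite mulr_le0_ge0// invr_ge0 ltW.
- have [c||c /itvP c0 gE] := @MVT R g (fun y => y ^+ 3 / (1 + y)) 0 x x0.
  + by rewrite in_itv/= => /andP[xc _]; apply: gD; exact: lt_trans xc.
  + apply: derivable_within_continuous => y; rewrite in_itv/= => /andP[xy _].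
    by apply: (@ex_derive _ _ _ _ _ _ _ (gD y _)); exact: lt_le_trans xy.
  have cl : 0 < c by rewrite c0.
  move: gE; rewrite g0 !subr0 => ->.
  by rewrite mulr_ge0 ?ltW// divr_gt0 ?exprn_gt0 ?addr_gt0.
Qed.

(** Kullback-Leibler divergence of Bernoulli(a) relative to Bernoulli(b). With the ratios inverted
    and the sign in front, upper bounds on [ln] become lower bounds on [kl]. *)
Definition kl {R : realType} (a b : R) :=
  - (a * ln (b / a) + (1 - a) * ln ((1 - b) / (1 - a))).

Lemma ln_div_le_cubic {R : realType} (a b : R) : 0 < a -> 0 < b ->
  ln (b / a) <= (b - a) / a - ((b - a) / a) ^+ 2 / 2 + ((b - a) / a) ^+ 3 / 3.
Proof.
move=> a0 b0.
have e : b / a = 1 + (b - a) / a by field; rewrite gt_eqF.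
rewrite [in leLHS]e ln1p_le_cubic// -subr_gt0 opprK addrC -e.
exact: divr_gt0.
Qed.

(** In the cubic bounds for both logarithms the first-order terms [b - a] and [a - b] cancel, which
    leaves the factor [(b - a) ^+ 2]. *)
Lemma kl_ge {R : realType} (a b : R) : 0 < a < 1 -> 0 < b < 1 ->
  (b - a) ^+ 2 * ((a^-1 + (1 - a)^-1) / 2
                  - (b - a) * (a ^- 2 - (1 - a) ^- 2) / 3) <= kl a b.
Proof.
move=> /andP[a0 a1] /andP[b0 b1].
have a1' : 0 < 1 - a by lra.
have b1' : 0 < 1 - b by lra.
rewrite /kl lerNr.
have l1 := ler_wpM2l (ltW a0) (ln_div_le_cubic a0 b0).
have l2 := ler_wpM2l (ltW a1') (ln_div_le_cubic a1' b1').
apply: le_trans (lerD l1 l2) _.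
rewrite le_eqVlt; apply/orP; left; apply/eqP; field.
by rewrite !gt_eqF.
Qed.

(** Inverting the ratios lets the same cubic bound work from above, now expanded around [b]. The
    first-order terms add up to [(b - a) ^+ 2 / (b * (1 - b))]. *)
Lemma kl_le {R : realType} (a b : R) : 0 < a < 1 -> 0 < b < 1 ->
  kl a b <= (b - a) ^+ 2 *
    ((b * (1 - b))^-1 - (a / b ^+ 2 + (1 - a) / (1 - b) ^+ 2) / 2
     + (b - a) * ((1 - a) / (1 - b) ^+ 3 - a / b ^+ 3) / 3).
Proof.
move=> /andP[a0 a1] /andP[b0 b1].
have a1' : 0 < 1 - a by lra.
have b1' : 0 < 1 - b by lra.
have -> : kl a b = a * ln (a / b) + (1 - a) * ln ((1 - a) / (1 - b)).
  rewrite /kl -(invf_div a b) -(invf_div (1 - a) (1 - b)).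
  by rewrite !lnV ?posrE ?divr_gt0// !mulrN -opprD opprK.
have l1 := ler_wpM2l (ltW a0) (ln_div_le_cubic b0 a0).
have l2 := ler_wpM2l (ltW a1') (ln_div_le_cubic b1' a1').
apply: le_trans (lerD l1 l2) _.
rewrite le_eqVlt; apply/orP; left; apply/eqP; field.
by rewrite !gt_eqF.
Qed.

(* Dividing by [(q - p)^2] and letting [q] tend to [p] turns both divergences
   into one half of the respective Fisher information. *)
Lemma kl_le_cramer_rao {R : realType} (f : R -> R) (p e : R) :
  0 < p < 1 -> derivable f p 1 -> 0 < f p < 1 ->
  (\forall q \near p, [/\ 0 < q < 1, 0 < f q < 1 &
    kl (f p) (f q) <= e * kl p q]) ->
  0 <= e ->
  derive1 f p ^+ 2 * (p * (1 - p) / (f p * (1 - f p))) <= e.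
Proof.
move=> p01 df fp01 nearp e0.
have /andP[p0 p1] := p01; have /andP[f0 f1] := fp01.
have p1' : 1 - p != 0 by rewrite subr_eq0 gt_eqF.
have f1' : 1 - f p != 0 by rewrite subr_eq0 gt_eqF.
have c0 : (h : R) @[h --> 0^'] --> (0 : R) by exact: cvg_within.
have cq : h + p @[h --> 0^'] --> p.
  by rewrite -[X in _ --> X]add0r; apply: cvgD => //; exact: cvg_cst.
have cf : f (h + p) @[h --> 0^'] --> f p.
  have /differentiable_continuous fc : differentiable f p by exact/derivable1_diffP.
  exact: (cvg_comp _ _ cq fc).
have cw : h^-1 * (f (h + p) - f p) @[h --> 0^'] --> derive1 f p.
  have := df; rewrite /derivable => /cvg_ex[l hl].
  rewrite derive1E /derive (cvg_lim _ hl)//.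
  suff -> : (fun h => h^-1 * (f (h + p) - f p)) =
      (fun h => h^-1 *: ((f \o shift p) (h *: (1 : R)) - f p)) by [].
  by apply/funext => h; rewrite /= /GRing.scale/= mulr1.
have cG : let b h := f (h + p) in let a := f p in
    ((a^-1 + (1 - a)^-1) / 2
      - (b h - a) * (a ^- 2 - (1 - a) ^- 2) / 3) @[h --> 0^'] -->
    ((f p)^-1 + (1 - f p)^-1) / 2.
  have -> : ((f p)^-1 + (1 - f p)^-1) / 2 = ((f p)^-1 + (1 - f p)^-1) / 2 -
      (f p - f p) * (f p ^- 2 - (1 - f p) ^- 2) / 3.
    by rewrite subrr !mul0r subr0.
  apply: cvgB; first exact: cvg_cst.
  do 2 (apply: cvgM; last exact: cvg_cst).
  by apply: cvgB => //; exact: cvg_cst.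
(* The bracket of [kl_le] at [a = p] and [b = h + p]; at [h = 0] it is half the Fisher information
   of Bernoulli(p). *)
pose U (h : R) := let b := h + p in ((b * (1 - b))^-1 - (p / b ^+ 2 + (1 - p) / (1 - b) ^+ 2) / 2
     + (b - p) * ((1 - p) / (1 - b) ^+ 3 - p / b ^+ 3) / 3).
have cU : U h @[h --> 0^'] --> U 0.
  have c1q : 1 - (h + p) @[h --> 0^'] --> 1 - (0 + p).
    by apply: cvgB; [exact: cvg_cst|rewrite add0r].
  have cq0 : h + p @[h --> 0^'] --> 0 + p by rewrite add0r.
  rewrite /U /=.
  apply: cvgD.
    apply: cvgB.
      apply: cvgV; first by rewrite add0r mulf_neq0 // gt_eqF.
      exact: cvgM.
    apply: cvgM; last exact: cvg_cst.
    apply: cvgD; apply: cvgM; try exact: cvg_cst.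
      apply: cvgV; first by rewrite add0r expf_neq0 // gt_eqF.
      exact: cvgM.
    apply: cvgV; first by rewrite add0r expf_neq0.
    exact: cvgM.
  apply: cvgM; last exact: cvg_cst.
  apply: cvgM.
    by apply: cvgB => //; exact: cvg_cst.
  apply: cvgB; apply: cvgM; try exact: cvg_cst.
    apply: cvgV; first by rewrite add0r expf_neq0.
    by apply: cvgM => //; exact: cvgM.
  apply: cvgV; first by rewrite add0r expf_neq0 // gt_eqF.
  by apply: cvgM => //; exact: cvgM.
have lim_le : derive1 f p ^+ 2 * (((f p)^-1 + (1 - f p)^-1) / 2) <= e * U 0.
  have cL := cvgM (cvgM cw cw) cG.
  have cR := cvgM (cvg_cst e) cU.
  rewrite expr2; apply: (ler_cvg_to (cL _ _) (cR _ _)); near=> h.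
  have h0 : h != 0 by near: h; exact: nbhs_dnbhs_neq.
  have [q01 fq01 klq] : [/\ 0 < h + p < 1, 0 < f (h + p) < 1 &
      kl (f p) (f (h + p)) <= e * kl p (h + p)].
    by near: h; exact: cq nearp.
  have h2 : 0 < h ^+ 2 by rewrite exprn_even_gt0.
  (* Multiplication by [h ^+ 2] turns the squared difference quotient into [(f (h + p) - f p) ^+ 2],
     the factor in [kl_ge], and supplies the factor in [kl_le]. *)
  rewrite -(ler_pM2l h2).
  have := le_trans (kl_ge fp01 fq01)
    (le_trans klq (ler_wpM2l e0 (kl_le p01 q01))).
  rewrite addrK => le_GU.
  rewrite /= [leRHS]mulrCA /U addrK. apply: le_trans le_GU.
  rewrite le_eqVlt; apply/orP; left; apply/eqP; field.
  by rewrite f1' h0 gt_eqF.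
move: lim_le.
have -> : U 0 = (p * (1 - p))^-1 / 2.
  rewrite /U add0r subrr !mul0r addr0; field.
  by rewrite p1' !gt_eqF.
have -> : ((f p)^-1 + (1 - f p)^-1) / 2 = (f p * (1 - f p))^-1 / 2.
  by field; rewrite f1' gt_eqF.
rewrite !mulrA ler_pM2r ?invr_gt0// => lim_le.
have pp0 : 0 < p * (1 - p) by rewrite mulr_gt0// subr_gt0.
rewrite ler_pdivlMr// in lim_le.
apply: le_trans lim_le.
by rewrite le_eqVlt; apply/orP; left; apply/eqP; ring.
Unshelve. all: by end_near.
Qed.

(** * Extracting a bit and a fresh uniform from one uniform *)

(** The pushforward of Lebesgue measure under the affine map, scaled by [1 / a], agrees with
    Lebesgue measure on half-open intervals, hence everywhere by uniqueness. *)
Lemma lebesgue_measure_affine_preimage {R : realType} (a c : R) (B : set R) :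
  0 < a -> measurable B ->
  lebesgue_measure ((fun u => (u - c) / a) @^-1` B) =
  (a%:E * lebesgue_measure B)%E.
Proof.
move=> a0 mB.
pose g (u : measurableTypeR R) : measurableTypeR R := (u - c) / a.
have mg : measurable_fun setT g.
  by apply: measurable_funM => //; exact: measurable_funB.
pose ia : {nonneg R} := NngNum (ltW (divr_gt0 ltr01 a0)).
pose mu := mscale ia (pushforward lebesgue_measure g).
have -> : lebesgue_measure B = mu mg B.
  apply: lebesgue_measure_unique => // _ [[x y]] _ <-.
  transitivity ((1 / a)%:E * lebesgue_measure (g @^-1` `]x, y]%classic))%E => //.
  have -> : g @^-1` `]x, y]%classic = `]a * x + c, a * y + c]%classic.
    apply/seteqP; split=> u; rewrite /= /g !in_itv/= ltr_pdivlMr// ler_pdivrMr// ltrBrDr lerBlDr;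
      by rewrite ![_ * a]mulrC.
  rewrite !lebesgue_measure_itv/= !lte_fin ltrD2r ltr_pM2l//.
  case: ifPn => _; last by rewrite mule0.
  rewrite -!EFinB -EFinM; congr EFin; field.
  by rewrite gt_eqF.
transitivity (a%:E * ((1 / a)%:E * lebesgue_measure (g @^-1` B)))%E => //.
by rewrite muleA -EFinM mulrA mulr1 divff ?gt_eqF// mul1e.
Qed.

(** Takes care of the endpoint 0, to which [rest_of q] sends [u = q]. *)
Lemma lebesgue_measureI_itvco01 {R : realType} (B : set R) : measurable B ->
  lebesgue_measure (B `&` `[0%R, 1%R[) = lebesgue_measure (B `&` `]0%R, 1%R[).
Proof.
move=> mB.
have -> : B `&` `[0%R, 1%R[ = (B `&` `]0%R, 1%R[) `|` (B `&` [set 0]).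
  rewrite -setIUr; congr (_ `&` _).
  by rewrite setUC setU1itv// bnd_simp.
rewrite measureU0//; first by apply: measurableI.
  by apply: measurableI.

apply/eqP; rewrite eq_le measure_ge0 andbT -[leRHS](lebesgue_measure_set1 (0 : R)).
apply: le_measure; rewrite ?inE//; exact: measurableI.
Qed.

(* A uniform [u] is traded for an independent pair: the bit [u < q], which is
   Bernoulli(q), and the relative position of [u] in [0, q) or [q, 1). *)
Definition bit_of {R : realType} (q u : R) : bool := u < q.
Definition rest_of {R : realType} (q u : R) : R :=
  if u < q then (u - 0) / q else (u - q) / (1 - q).

Lemma measurable_bit_of {R : realType} (q : R) :
  measurable_fun [set: R] (bit_of q).
Proof. exact: measurable_fun_ltr. Qed.

Lemma measurable_rest_of {R : realType} (q : R) :
  measurable_fun [set: R] (rest_of q).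
Proof.
apply: measurable_fun_ifT; first exact: measurable_fun_ltr.
- by apply: measurable_funM => //; exact: measurable_funB.
- by apply: measurable_funM => //; exact: measurable_funB.
Qed.

(** On each side of [q] the map [rest_of q] is affine onto the unit interval, so preimages of [B]
    are scaled by [q] and by [1 - q], the weights of the two bits. *)
Lemma bit_rest_law {R : realType} (q : R) (A : set bool) (B : set R) :
  0 < q < 1 -> measurable B ->
  lebesgue_measure ((bit_of q @^-1` A `&` rest_of q @^-1` B) `&` `]0%R, 1%R[) =
  (bern_mass q A * lebesgue_measure (B `&` `]0%R, 1%R[))%E.
Proof.
move=> /andP[q0 q1] mB.
have q1' : 0 < 1 - q by rewrite subr_gt0.
have mBo : measurable (B `&` `]0%R, 1%R[) by exact: measurableI.
have mBc : measurable (B `&` `[0%R, 1%R[) by exact: measurableI.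
(* The piece [u < q] maps to the open interval; the other piece contains [u = q], hence the
   half-open interval in [C2]. *)
pose C1 := (fun u : R => (u - 0) / q) @^-1` (B `&` `]0%R, 1%R[) `&` [set _ | A true].
pose C2 := (fun u : R => (u - q) / (1 - q)) @^-1` (B `&` `[0%R, 1%R[) `&` [set _ | A false].
have -> : (bit_of q @^-1` A `&` rest_of q @^-1` B) `&` `]0%R, 1%R[ = C1 `|` C2.
  apply/seteqP; split=> u.
    rewrite /= in_itv/= => -[[]] + + /andP[u0 u1].
    rewrite /bit_of /rest_of; case: ltP => uq Au Bu.
      left; split => //; split => //=.
      by rewrite in_itv/= subr0 divr_gt0// ltr_pdivrMr// mul1r.
    right; split => //; split => //=.
    rewrite in_itv/= divr_ge0// ?subr_ge0// ?ltW//.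
    by rewrite ltr_pdivrMr// mul1r ltrD2r.
  rewrite /C1 /C2 /= !in_itv/= => -[[[Bu /andP[u0 u1]] Au]|[[Bu /andP[u0 u1]] Au]].
    move: u0 u1; rewrite subr0 pmulr_lgt0 ?invr_gt0// ltr_pdivrMr// mul1r => u0 u1.
    by rewrite /bit_of /rest_of u1 u0 /= (lt_trans u1).
  move: u0 u1; rewrite pmulr_lge0 ?invr_gt0// ltr_pdivrMr// mul1r ltrD2r subr_ge0 => u0 u1.
  by rewrite /bit_of /rest_of ltNge u0 /= u1 (lt_le_trans q0).
have mA P : measurable [set _ : R | P] by case: (pselect P) => h;
  [rewrite (_ : [set _ | _] = setT)//; apply/seteqP; split
  |rewrite (_ : [set _ | _] = set0)//; apply/seteqP; split].
have mC1 : measurable C1.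
  apply: measurableI => //; rewrite -[X in measurable X]setTI.
  apply: measurable_funM mBo => //; exact: measurable_funB.
have mC2 : measurable C2.
  apply: measurableI => //; rewrite -[X in measurable X]setTI.
  apply: measurable_funM mBc => //; exact: measurable_funB.
rewrite measureU//; last first.
  rewrite -subset0 => u; rewrite /C1 /C2 /= !in_itv/= => -[[[_ /andP[_ +]] _] [[_ /andP[+ _]] _]].
  by rewrite subr0 ltr_pdivrMr// mul1r pmulr_lge0 ?invr_gt0// subr_ge0 ltNge => /negP.
have IT (C : set R) (P : Prop) : (C `&` [set _ | P]) = if `[< P >] then C else set0.
  case: asboolP => h; first by apply/seteqP; split=> x //= [].
  by apply/seteqP; split=> x //= [].
rewrite /C1 /C2 !IT// /bern_mass EFinD ge0_muleDl.
congr (_ + _)%E.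
- case: ifP => _; last by rewrite measure0 mul0e.
  exact: lebesgue_measure_affine_preimage.
- case: ifP => _; last by rewrite measure0 mul0e.
  by rewrite -lebesgue_measureI_itvco01//; exact: lebesgue_measure_affine_preimage.
- by case: ifP => _; rewrite lee_fin// ltW.
- by case: ifP => _; rewrite lee_fin// ltW.
Qed.

(** Each new pair is a function of a single [U i]. Constraining every [X i] by [setT] makes its
    factor 1 and leaves a product over the uniforms, evaluated by [bit_rest_law]. *)
Lemma iid_setting_relabel {R : realType} d (T : measurableType d)
    (P : probability T R) (p q : R) (X : nat -> T -> bool) (U : nat -> T -> R) :
  0 < q < 1 -> iid_setting P p X U ->
  iid_setting P q (fun i => bit_of q \o U i) (fun i => rest_of q \o U i).
Proof.
move=> q01 [mX [mU iid]]; split.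
  by move=> i; apply: measurableT_comp => //; exact: measurable_bit_of.
split.
  by move=> i; apply: measurableT_comp => //; exact: measurable_rest_of.
move=> n A B mB.
have mC i : measurable (bit_of q @^-1` A i `&` rest_of q @^-1` B i).
  apply: measurableI; rewrite -[X in measurable X]setTI.
    exact: measurable_bit_of.
  exact: measurable_rest_of.
have := iid n (fun=> setT) _ mC.
under eq_bigcapr do rewrite preimage_setT setTI preimage_setI.
move=> ->; apply: eq_bigr => i _.
rewrite bit_rest_law// [bern_mass p _]/bern_mass !asboolT//.
by rewrite addrC subrK mul1e.
Qed.

(** * Bit words, rectangles and change of measure *)

(** Likelihood of a word under Bernoulli(p); [wt q s / wt p s] is the likelihood ratio. *)
Definition wt {R : realType} (p : R) (s : seq bool) : R :=
  \prod_(b <- s) (if b then p else 1 - p).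

Definition word {T : Type} (X : nat -> T -> bool) (s : seq bool) : set T :=
  [set t | forall i, (i < size s)%N -> X i t = nth false s i].

Definition rect {R : realType} n (A : nat -> set bool) (B : nat -> set R) :
    set (n.-tuple (bool * R)) :=
  [set z | forall i : 'I_n, A i (tnth z i).1 /\ B i (tnth z i).2].
Arguments rect {R} n A B.

Lemma wt_gt0 {R : realType} (p : R) (s : seq bool) : 0 < p < 1 -> 0 < wt p s.
Proof.
move=> /andP[p0 p1]; rewrite /wt; apply: prodr_gt0 => b _.
by case: b; rewrite ?subr_gt0.
Qed.

Lemma wt_rcons {R : realType} (p : R) (s : seq bool) b :
  wt p (rcons s b) = wt p s * (if b then p else 1 - p).
Proof. by rewrite /wt -cats1 big_cat big_seq1. Qed.

Lemma measurable_rect {R : realType} n (A : nat -> set bool)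
    (B : nat -> set R) :
  (forall i, measurable (B i)) -> measurable (rect n A B).
Proof.
move=> mB.
have -> : rect n A B = \bigcap_(i : 'I_n)
    ((fun z : n.-tuple (bool * R) => tnth z i) @^-1` (A i `*` B i)).
  by apply/seteqP; split=> z /= h i => [_|]; [exact: h|exact: (h i I)].
apply: fin_bigcap_measurable => // i _.
rewrite -[X in measurable X]setTI; apply: measurable_tnth => //.
exact: measurableX.
Qed.

(** Rectangles are to serve as a generating pi-system for uniqueness of measures. That they generate
    is checked coordinatewise on the identity map: a cylinder is a rectangle with full sides
    elsewhere. *)
Lemma measurable_tupleE {R : realType} n :
  @measurable _ (n.-tuple (bool * R)) =
  <<s [set C | exists (A : nat -> set bool) (B : nat -> set R),
        (forall i, measurable (B i)) /\ C = rect n A B] >>.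
Proof.
set G := [set C | _].
apply/seteqP; split; last first.
  apply: smallest_sub; first exact: sigma_algebra_measurable.
  by move=> _ [A [B [mB ->]]]; exact: measurable_rect.
have mid : measurable_fun [set: g_sigma_algebraType G]
    (fun z : g_sigma_algebraType G => z : n.-tuple (bool * R)).
  apply/measurable_fun_tnthP => i; apply/measurable_fun_pairP; split.
    move=> _ D _; rewrite setTI; apply: sub_sigma_algebra.
    exists (fun j => if j == i :> nat then D else setT), (fun=> setT); split => //.
    apply/seteqP; split=> z /=.
      move=> Dz j; split=> //; case: ifPn => // /eqP ji.
      by have -> : j = i by exact/val_inj.
    by move=> /(_ i)[]; rewrite eqxx.
  move=> _ D mD; rewrite setTI; apply: sub_sigma_algebra.
  exists (fun=> setT), (fun j => if j == i :> nat then D else setT); split.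
    by move=> j; case: ifP.
  apply/seteqP; split=> z /=.
    move=> Dz j; split=> //; case: ifPn => // /eqP ji.
    by have -> : j = i by exact/val_inj.
  by move=> /(_ i)[_]; rewrite eqxx.
by move=> C mC; have := mid measurableT _ mC; rewrite setTI.
Qed.

Lemma measure_unique_rect {R : realType} n
    (m1 m2 : {measure set (n.-tuple (bool * R)) -> \bar R}) :
  (m1 setT < +oo)%E ->
  (forall (A : nat -> set bool) (B : nat -> set R),
    (forall i, measurable (B i)) -> m1 (rect n A B) = m2 (rect n A B)) ->
  forall C, measurable C -> m1 C = m2 C.
Proof.
move=> m1oo m12.
apply: (measure_unique _ (fun=> setT) (measurable_tupleE n)) => //.
- move=> _ _ [A [B [mB ->]]] [A' [B' [mB' ->]]].
  exists (fun i => A i `&` A' i), (fun i => B i `&` B' i); split.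
    by move=> i; exact: measurableI.
  apply/seteqP; split=> z /=.
    by move=> [h h'] i; have [] := h i; have [] := h' i.
  by move=> h; split=> i; have [[? ?] [? ?]] := h i.
- move=> _; exists (fun=> setT), (fun=> setT); split => //.
  by apply/seteqP; split.
- by apply/seteqP; split=> // z _; exists 0%N.
- by move=> _ [A [B [mB ->]]]; exact: m12.
Qed.

Section Process.
Context {R : realType} d (T : measurableType d) (P : probability T R).
Implicit Types (X : nat -> T -> bool) (U : nat -> T -> R) (s : seq bool).

Lemma measurable_obs p X U n :
  iid_setting P p X U -> measurable_fun setT (obs X U n).
Proof.
move=> [mX [mU _]]; apply/measurable_fun_tnthP => i.
have -> : (tnth (T:=bool * R))^~ i \o obs X U n = fun t => (X i t, U i t).
  by apply/funext => t /=; rewrite tnth_mktuple.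
exact: measurable_fun_pair.
Qed.

Lemma measurable_word X s :
  (forall i, measurable_fun setT (X i)) -> measurable (word X s).
Proof.
move=> mX.
have -> : word X s = \bigcap_(i < size s) (X i @^-1` [set nth false s i]).
  by apply/seteqP; split.
apply: bigcap_measurableType => i _.
by rewrite -[X in measurable X]setTI; exact: mX.
Qed.

(** Both events constrain coordinates separately, so their intersection is again a product event.
    The word fixes the bits and leaves the uniforms free, which splits off the weight [wt p s]. *)
Lemma prob_rect_word p X U k s (A : nat -> set bool) (B : nat -> set R) :
  iid_setting P p X U -> (k <= size s)%N -> (forall i, measurable (B i)) ->
  P (obs X U k @^-1` rect k A B `&` word X s) =
  ((wt p s)%:E * \prod_(i < k) ((if `[< A i (nth false s i) >] then 1 else 0)%:E
    * lebesgue_measure (B i `&` `]0%R, 1%R[)))%E.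
Proof.
move=> [mX [mU iid]] ks mB.
pose A' i := [set b | b = nth false s i /\ ((i < k)%N -> A i b)].
pose B' i := if (i < k)%N then B i else setT.
have -> : obs X U k @^-1` rect k A B `&` word X s =
    \bigcap_(i in `I_(size s)) (X i @^-1` A' i `&` U i @^-1` B' i).
  apply/seteqP; split=> t /=.
    move=> [h w] i /= si; rewrite /A' /B' /= w//; split.
      split=> // ik; have := h (Ordinal ik).
      by rewrite tnth_mktuple/= w// => -[].
    case: ifPn => // ik; have := h (Ordinal ik).
    by rewrite tnth_mktuple/= => -[].
  move=> h; split.
    move=> i; rewrite tnth_mktuple/=.
    have [|/= [_ Ai]] := h i; first exact: leq_trans ks.
    by rewrite /B' ltn_ord => Bi; split => //; exact: Ai.
  by move=> i si; have [|[]] := h i.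
rewrite iid; last by move=> i; rewrite /B'; case: ifP.
(* From [k] on the uniform is unconstrained and contributes the measure 1 of the unit interval, so
   the product over the word can be cut at [k]. *)
pose g i := (if (i < k)%N then (if `[< A i (nth false s i) >] then 1 else 0)%:E
    * lebesgue_measure (B i `&` `]0%R, 1%R[) else 1)%E.
rewrite (eq_bigr (fun i : 'I_(size s) =>
    (if nth false s i then p else 1 - p)%:E * g i)%E); last first.
  move=> i _.
  have -> : bern_mass p (A' i) = ((if nth false s i then p else 1 - p)%:E *
      (if `[< (i < k)%N -> A i (nth false s i) >] then 1 else 0)%:E)%E.
    have A'E b : `[< A' i b >] =
        (b == nth false s i) && `[< (i < k)%N -> A i (nth false s i) >].
      apply/asboolP/andP => [[-> h]|[/eqP-> /asboolP h]]; split=> //.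
      exact/asboolP.
    rewrite /bern_mass !A'E -EFinM; congr EFin.
    by case: (nth false s i) => /=; case: asbool; rewrite ?mulr1 ?mulr0 ?addr0 ?add0r.
  rewrite -muleA; congr (_ * _)%E.
  rewrite /g /B'; have [ik|ik] := ltnP i k.
    suff -> : `[< true -> A i (nth false s i) >] = `[< A i (nth false s i) >] by [].
    by apply/asboolP/asboolP => [h|h _ //]; exact: h.
  rewrite asboolT// setTI mul1e lebesgue_measure_itv/= lte01.
  by rewrite sube0.
rewrite big_split/=; congr (_ * _)%E.
  rewrite /wt (big_nth false) big_mkord.
  by rewrite prodEFin.
rewrite -(big_mkord xpredT g) (big_cat_nat (n := k))//= [X in (_ * X)%E]big1_seq ?mule1.
  by rewrite big_mkord; apply: eq_bigr => i _; rewrite /g ltn_ord.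
by move=> i /andP[_]; rewrite mem_index_iota /g => /andP[ki _]; rewrite ltnNge ki.
Qed.

(** Given the bits, only the uniforms remain random, and their law does not depend on the parameter;
    on rectangles both sides are [wt p s * wt q s'] times a common factor. The words may differ
    beyond [k], which allows a word to be compared with its one-bit extension. *)
Lemma prob_obs_word p q X U Y V k s s' (C : set (k.-tuple (bool * R))) :
  iid_setting P p X U -> iid_setting P q Y V -> 0 < p < 1 -> 0 < q < 1 ->
  (k <= size s)%N -> (k <= size s')%N -> take k s = take k s' ->
  measurable C ->
  wt q s' * fine (P (obs X U k @^-1` C `&` word X s)) =
  wt p s * fine (P (obs Y V k @^-1` C `&` word Y s')).
Proof.
move=> iX iY p01 q01 ks ks' ss' mC.
have mwX : measurable (word X s) by apply: measurable_word; case: iX.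
have mwY : measurable (word Y s') by apply: measurable_word; case: iY.
have moX := measurable_obs (n := k) iX.
have moY := measurable_obs (n := k) iY.
have mo Z (W : nat -> T -> R) (c : set (k.-tuple (bool * R)))
      (mo' : measurable_fun setT (obs Z W k)) : measurable c ->
    measurable (obs Z W k @^-1` c).
  by move=> mc; rewrite -[X in measurable X]setTI; exact: (mo' measurableT _ mc).
(* The two sides as measures of [C], so that comparison on rectangles suffices. *)
pose m1 := mscale (NngNum (ltW (wt_gt0 s' q01)))
  (pushforward (mrestr P mwX) (obs X U k)).
pose m2 := mscale (NngNum (ltW (wt_gt0 s p01)))
  (pushforward (mrestr P mwY) (obs Y V k)).
have m12 : m1 moX C = m2 moY C.
  apply: measure_unique_rect mC.
    change ((wt q s')%:E * P (setT `&` word X s) < +oo)%E.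
    by rewrite setTI ltey_eq fin_numM// fin_num_measure.
  move=> A B mB.
  change ((wt q s')%:E * P (obs X U k @^-1` rect k A B `&` word X s) =
    (wt p s)%:E * P (obs Y V k @^-1` rect k A B `&` word Y s'))%E.
  rewrite (prob_rect_word _ iX)// (prob_rect_word _ iY)// !muleA.
  congr (_ * _)%E; first by rewrite -!EFinM mulrC.
  apply: eq_bigr => i _.
  by rewrite -(nth_take _ (ltn_ord i) s) -(nth_take _ (ltn_ord i) s') ss'.
have {}m12 : ((wt q s')%:E * P (obs X U k @^-1` C `&` word X s) =
    (wt p s)%:E * P (obs Y V k @^-1` C `&` word Y s'))%E by exact: m12.
apply: EFin_inj; rewrite !EFinM !fineK//.
- by apply: fin_num_measure; apply: measurableI => //; exact: mo.
- by apply: fin_num_measure; apply: measurableI => //; exact: mo.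
Qed.

End Process.

(** * Sums over bit words *)

(** The recursion branches on the last bit, so that passing from [n] to [n.+1] observations is a
    computation step. *)
Fixpoint wsum {R : realType} n (F : seq bool -> R) : R :=
  if n is m.+1 then wsum m (fun s => F (rcons s true) + F (rcons s false))
  else F [::].

Lemma le_wsum {R : realType} n (F G : seq bool -> R) :
  (forall s, size s = n -> F s <= G s) -> wsum n F <= wsum n G.
Proof.
elim: n F G => [|n IH] F G FG /=; first exact: FG.
by apply: IH => s sn; apply: lerD; apply: FG; rewrite size_rcons sn.
Qed.

Lemma eq_wsum {R : realType} n (F G : seq bool -> R) :
  (forall s, size s = n -> F s = G s) -> wsum n F = wsum n G.
Proof. by move=> FG; apply/le_anti/andP; split; apply: le_wsum => s /FG ->. Qed.

Lemma wsum_lin {R : realType} n (a b : R) (F G : seq bool -> R) :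
  wsum n (fun s => a * F s + b * G s) = a * wsum n F + b * wsum n G.
Proof.
elim: n F G => //= n IH F G; rewrite -IH; apply: eq_wsum => s _.
by rewrite !mulrDr addrACA.
Qed.

Lemma wsumD {R : realType} n (F G : seq bool -> R) :
  wsum n (fun s => F s + G s) = wsum n F + wsum n G.
Proof.
have := wsum_lin n 1 1 F G; rewrite !mul1r => <-.
by apply: eq_wsum => s _; rewrite !mul1r.
Qed.

(** * Stopping events as sets of observation tuples *)

Section Prefix.
Context {R : realType}.

(** The default [(true, 0)] is read only when [k > n]; totality avoids casts between tuple
    lengths. *)
Definition prefix k n (z : n.-tuple (bool * R)) : k.-tuple (bool * R) :=
  [tuple nth (true, 0) z i | i < k].
Arguments prefix k {n} z.

Lemma prefix_obs T (X : nat -> T -> bool) (U : nat -> T -> R) k n t :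
  (k <= n)%N -> prefix k (obs X U n t) = obs X U k t.
Proof.
move=> kn; apply: eq_from_tnth => i; rewrite !tnth_mktuple.
have iN := leq_trans (ltn_ord i) kn.
by rewrite -(tnth_nth (true, 0) (obs X U n t) (Ordinal iN)) tnth_mktuple.
Qed.

Lemma measurable_prefix k n :
  measurable_fun setT (@prefix k n : n.-tuple (bool * R) -> _).
Proof.
apply/measurable_fun_tnthP => i.
have [iN|ni] := ltnP i n.
  have -> : (tnth (T:=bool * R))^~ i \o @prefix k n = fun z => tnth z (Ordinal iN).
    by apply/funext => z /=; rewrite tnth_mktuple (tnth_nth (true, 0)).
  exact: measurable_tnth.
have -> : (tnth (T:=bool * R))^~ i \o @prefix k n = cst (true, 0).
  by apply/funext => z /=; rewrite tnth_mktuple nth_default// size_tuple.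
exact: measurable_cst.
Qed.

Context (tau gamma : @stopfun R).
Arguments tau : clear implicits.
Arguments gamma : clear implicits.

(** [go_on n] encodes N > n, and [fire b n] encodes N = n + 1 with output [b]. Being sets of tuples,
    they can be pulled back along both experiments. *)
Definition go_on n : set (n.-tuple (bool * R)) :=
  [set z | forall k, (k < n)%N -> ~~ tau k (prefix k.+1 z)].

Definition fire b n : set (n.+1.-tuple (bool * R)) :=
  [set z | [/\ @go_on n (prefix n z), tau n z & gamma n z = b]].
Arguments fire : clear implicits.
Arguments go_on : clear implicits.

Lemma measurable_go_on n : measurable_factory tau gamma -> measurable (go_on n).
Proof.
move=> [mtau _].
have -> : go_on n = \bigcap_(k < n) ((tau k \o @prefix k.+1 n) @^-1` [set false]).
  by apply/seteqP; split=> z h k kn; have := h k kn; [move/negPf|move=> /= ->].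
apply: bigcap_measurableType => k _; rewrite -[X in measurable X]setTI.
exact: (measurableT_comp (mtau k) (@measurable_prefix k.+1 n)).
Qed.

Lemma measurable_fire b n : measurable_factory tau gamma -> measurable (fire b n).
Proof.
move=> mf; have [mtau mgam] := mf.
have -> : fire b n = (@prefix n n.+1 @^-1` go_on n) `&` (tau n @^-1` [set true])
    `&` (gamma n @^-1` [set b]).
  by apply/seteqP; split=> [z [? ? ?]|z [[? ?] ?]].
apply: measurableI; last by rewrite -[X in measurable X]setTI; exact: mgam.
apply: measurableI; last by rewrite -[X in measurable X]setTI; exact: mtau.
rewrite -[X in measurable X]setTI; apply: (@measurable_prefix n n.+1) => //.
exact: measurable_go_on.
Qed.

Definition stop T (X : nat -> T -> bool) (U : nat -> T -> R) b n : set T :=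
  obs X U n.+1 @^-1` fire b n.

Lemma N_gtE T (X : nat -> T -> bool) (U : nat -> T -> R) n :
  N_gt tau X U n = obs X U n @^-1` go_on n.
Proof.
by apply/seteqP; split=> t /= h k kn; have := h k kn; rewrite prefix_obs.
Qed.

Lemma stopE T (X : nat -> T -> bool) (U : nat -> T -> R) b n :
  stop X U b n = [set t | [/\ N_gt tau X U n t, tau n (obs X U n.+1 t) &
    gamma n (obs X U n.+1 t) = b]].
Proof.
rewrite N_gtE.
by apply/seteqP; split=> t /=; rewrite /stop /fire /= prefix_obs.
Qed.

Lemma N_gtS T (X : nat -> T -> bool) (U : nat -> T -> R) n :
  N_gt tau X U n =
  N_gt tau X U n.+1 `|` (stop X U true n `|` stop X U false n).
Proof.
rewrite !stopE; apply/seteqP; split=> t /=.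
  move=> h; case taun: (tau n (obs X U n.+1 t)).
    by right; case: (gamma n _); [left|right].
  left=> k; rewrite ltnS leq_eqVlt => /orP[/eqP ->|]; first by rewrite taun.
  exact: h.
by move=> [h k kn|[[]|[]]]//; apply: h; exact: ltnW.
Qed.

Lemma stop_disjoint T (X : nat -> T -> bool) (U : nat -> T -> R) b b' m n :
  (m < n)%N -> stop X U b m `&` stop X U b' n = set0.
Proof.
move=> mn; rewrite !stopE -subset0 => t /= [[_ taum _] [h _ _]].
by have := h m mn; rewrite taum.
Qed.

End Prefix.
Arguments stop {R} tau gamma {T} X U b n.

(** * Real-valued probabilities and their refinement by words *)

Section FineProb.
Context {R : realType} d (T : measurableType d) (P : probability T R).

Lemma fine_probU (A B : set T) : measurable A -> measurable B ->
  A `&` B = set0 -> fine (P (A `|` B)) = fine (P A) + fine (P B).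
Proof. by move=> mA mB AB; rewrite measureU// fineD// fin_num_measure. Qed.

Lemma fine_probI2U (A B W : set T) : measurable A -> measurable B ->
  measurable W -> A `&` B = set0 ->
  fine (P ((A `|` B) `&` W)) = fine (P (A `&` W)) + fine (P (B `&` W)).
Proof.
move=> mA mB mW AB; rewrite setIUl fine_probU//; try exact: measurableI.
by rewrite setIACA AB set0I.
Qed.

Lemma cvg_sum_fine_prob (F : nat -> set T) :
  (forall n, measurable (F n)) -> trivIset setT F ->
  \sum_(0 <= k < n) fine (P (F k)) @[n --> \oo] --> fine (P (\bigcup_k F k)).
Proof.
move=> mF tF.
have Pfin : (P (\bigcup_k F k)) \is a fin_num.
  by apply: fin_num_measure; exact: bigcup_measurable.
have h : (fun n => \sum_(0 <= k < n) P (F k))%E @ \oo --> (fine (P (\bigcup_k F k)))%:E.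
  by rewrite fineK//; exact: measure_sigma_additive.
have -> : (fun n => \sum_(0 <= k < n) fine (P (F k))) =
    fine \o (fun n => \sum_(0 <= k < n) P (F k))%E; last exact: fine_cvg h.
apply/funext => n /=; rewrite sum_fine// => k _.
exact: fin_num_measure.
Qed.

Lemma prob_word_rcons (X : nat -> T -> bool) s (A : set T) :
  (forall i, measurable_fun setT (X i)) -> measurable A ->
  fine (P (A `&` word X (rcons s true))) + fine (P (A `&` word X (rcons s false)))
  = fine (P (A `&` word X s)).
Proof.
move=> mX mA.
have wE b : word X (rcons s b) = word X s `&` X (size s) @^-1` [set b].
  apply/seteqP; split=> t /=.
    move=> h; split.
      move=> i si; have := h i; rewrite size_rcons nth_rcons si; apply.
      exact: ltnW.
    by have := h (size s); rewrite size_rcons nth_rcons ltnn eqxx => ->.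
  move=> [h hs] i; rewrite size_rcons nth_rcons ltnS leq_eqVlt => /orP[/eqP ->|si].
    by rewrite ltnn eqxx.
  by rewrite si h.
rewrite -fine_probU; last 3 first.
- by apply: measurableI => //; exact: measurable_word.
- by apply: measurableI => //; exact: measurable_word.
- rewrite !wE -subset0 => t /= [[_ [_ ht]] [_ [_]]].
  by rewrite ht.
congr (fine (P _)); rewrite !wE -!setIUr.
rewrite -preimage_setU (_ : [set true] `|` [set false] = setT) ?preimage_setT ?setIT//.
by apply/seteqP; split=> // -[] _; [left|right].
Qed.

Lemma wsum_prob_word (X : nat -> T -> bool) n (A : set T) :
  (forall i, measurable_fun setT (X i)) -> measurable A ->
  wsum n (fun s => fine (P (A `&` word X s))) = fine (P A).
Proof.
move=> mX mA; elim: n => [|n IH] /=.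
  by congr (fine (P _)); apply/seteqP; split=> [t []|t At]//; split=> // i.
by rewrite -IH; apply: eq_wsum => s _; rewrite prob_word_rcons.
Qed.

End FineProb.

(** * Divergence of the stopped experiment *)

(** By [ln x <= x - 1] the two terms inside [kl] are at most [b - a] and [a - b]. *)
Lemma kl_ge0 {R : realType} (a b : R) : 0 < a < 1 -> 0 < b < 1 -> 0 <= kl a b.
Proof.
move=> /andP[a0 a1] /andP[b0 b1].
have ln_le (u v : R) : 0 < u -> 0 < v -> u * ln (v / u) <= v - u.
  move=> u0 v0; have -> : v - u = u * (v / u - 1) by field; rewrite gt_eqF.
  rewrite ler_pM2l// -{1}(subrKC 1 (v / u)) le_ln1Dx//.
  by rewrite ltrBrDl subrr divr_gt0.
have h1 := ln_le _ _ a0 b0.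
have h2 : (1 - a) * ln ((1 - b) / (1 - a)) <= (1 - b) - (1 - a).
  by apply: ln_le; rewrite subr_gt0.
by rewrite /kl; lra.
Qed.

Section Divergence.
Context {R : realType} d (T : measurableType d) (P : probability T R).
Context (tau gamma : @stopfun R) (p q : R).
Context (X Y : nat -> T -> bool) (U V : nat -> T -> R).
Arguments tau : clear implicits.
Arguments gamma : clear implicits.
Context (mf : measurable_factory tau gamma).
Context (iX : iid_setting P p X U) (iY : iid_setting P q Y V).
Context (p01 : 0 < p < 1) (q01 : 0 < q < 1).

Implicit Types (Z : nat -> T -> bool) (W : nat -> T -> R).

Let pr (A : set T) : R := fine (P A).
Let llr s : R := ln (wt q s / wt p s).
Let stopX := stop tau gamma X U.
Let stopY := stop tau gamma Y V.

Let mX i : measurable_fun setT (X i). Proof. by case: iX. Qed.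
Let mY i : measurable_fun setT (Y i). Proof. by case: iY. Qed.

Lemma measurable_obs_preimage r Z W n (C : set (n.-tuple (bool * R))) :
  iid_setting P r Z W -> measurable C -> measurable (obs Z W n @^-1` C).
Proof.
move=> iZ mC; rewrite -[X in measurable X]setTI.
exact: (measurable_obs (n := n) iZ measurableT mC).
Qed.

Lemma measurable_stop r Z W b n :
  iid_setting P r Z W -> measurable (stop tau gamma Z W b n).
Proof.
by move=> iZ; apply: (measurable_obs_preimage iZ); exact: measurable_fire.
Qed.

Lemma measurable_N_gt r Z W n :
  iid_setting P r Z W -> measurable (N_gt tau Z W n).
Proof.
move=> iZ; rewrite N_gtE; apply: (measurable_obs_preimage iZ).
exact: measurable_go_on mf.
Qed.

Lemma N_gt_stop_disjoint Z W b n :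
  N_gt tau Z W n.+1 `&` stop tau gamma Z W b n = set0.
Proof.
rewrite stopE -subset0 => t /= [h [_ taun _]].
by have := h n (ltnSn n); rewrite taun.
Qed.

Lemma stop_labels_disjoint Z W n :
  stop tau gamma Z W true n `&` stop tau gamma Z W false n = set0.
Proof. by rewrite !stopE -subset0 => t /= [[_ _ ->] []]. Qed.

Lemma fine_prob_N_gtS r Z W (E : set T) n :
  iid_setting P r Z W -> measurable E ->
  pr (N_gt tau Z W n `&` E) = pr (N_gt tau Z W n.+1 `&` E) +
    (pr (stop tau gamma Z W true n `&` E) + pr (stop tau gamma Z W false n `&` E)).
Proof.
move=> iZ mE; rewrite /pr (N_gtS tau gamma).
have mS b := measurable_stop b n iZ.
rewrite fine_probI2U//; last 3 first.
- exact: measurable_N_gt iZ.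
- exact: measurableU.
- by rewrite setIUr !N_gt_stop_disjoint setU0.
by rewrite [in X in _ + X = _]fine_probI2U// stop_labels_disjoint.
Qed.

Lemma fine_prob_N_gt r Z W n : iid_setting P r Z W ->
  pr (N_gt tau Z W n) = 1 - \sum_(0 <= k < n)
    (pr (stop tau gamma Z W true k) + pr (stop tau gamma Z W false k)).
Proof.
move=> iZ; elim: n => [|n IH].
  rewrite big_geq// subr0 /pr (_ : N_gt _ _ _ _ = setT) ?probability_setT//.
  by apply/seteqP; split.
have := fine_prob_N_gtS n iZ measurableT; rewrite !setIT IH big_nat_recr//= => h.
by rewrite opprD addrA h addrK.
Qed.

(* The step from [n] to [n.+1]: conditionally on [X_0, ..., X_(n-1)] and [N > n],
   the next bit adds [- kl p q] on average to the log-likelihood ratio. *)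
Lemma llr_step n :
  wsum n (fun s => pr (N_gt tau X U n `&` word X s) * llr s)
    - kl p q * pr (N_gt tau X U n) =
  wsum n.+1 (fun s => pr (N_gt tau X U n.+1 `&` word X s) * llr s) +
  (wsum n.+1 (fun s => pr (stopX true n `&` word X s) * llr s) +
   wsum n.+1 (fun s => pr (stopX false n `&` word X s) * llr s)).
Proof.
rewrite -!wsumD.
(* The middle term keeps the event N > n but sums over words of length [n.+1]: one side differs from
   it by the added bit, the other by splitting the event. *)
transitivity (wsum n.+1 (fun s => pr (N_gt tau X U n `&` word X s) * llr s)); last first.
  apply: eq_wsum => s _.
  rewrite (fine_prob_N_gtS n iX); last exact: measurable_word.
  by rewrite !mulrDl.
have mN := measurable_N_gt n iX.
have -> : pr (N_gt tau X U n) = wsum n (fun s => pr (N_gt tau X U n `&` word X s)).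
  by rewrite /pr wsum_prob_word.
rewrite [in RHS]/=.
rewrite -[X in X - _]mul1r -mulNr -wsum_lin; apply: eq_wsum => s sn.
(* N > n is decided by the first [n] observations, so the next bit is independent of it: this is
   [prob_obs_word] with both experiments equal and words differing by one bit. *)
have stepE b : pr (N_gt tau X U n `&` word X (rcons s b)) =
    (if b then p else 1 - p) * pr (N_gt tau X U n `&` word X s).
  rewrite /pr N_gtE; apply: (mulfI (lt0r_neq0 (wt_gt0 s p01))).
  rewrite (prob_obs_word (s' := s) iX iX)// ?size_rcons ?sn//; last 2 first.
    by rewrite -cats1 takel_cat ?sn.
    exact: measurable_go_on mf.
  by rewrite wt_rcons mulrA.
have /andP[p0 p1] := p01; have /andP[q0 q1] := q01.
have llrE b : llr (rcons s b) = llr s +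
    ln ((if b then q else 1 - q) / (if b then p else 1 - p)).
  rewrite /llr !wt_rcons -lnM ?posrE ?divr_gt0 ?wt_gt0//;
    try by case: b; rewrite ?subr_gt0.
  by congr ln; rewrite mulf_div.
rewrite !stepE !llrE /kl /=; ring.
Qed.

(* [ln L <= ln c - 1 + L / c] for every [c > 0], applied to the likelihood
   ratio [L], whose integral against [P] is the probability under [q]. *)
Lemma llr_le n (C : set (n.-tuple (bool * R))) (c : R) : 0 < c -> measurable C ->
  wsum n (fun s => pr (obs X U n @^-1` C `&` word X s) * llr s) <=
  (ln c - 1) * pr (obs X U n @^-1` C) + c^-1 * pr (obs Y V n @^-1` C).
Proof.
move=> c0 mC.
have mCX := measurable_obs_preimage iX mC.
have mCY := measurable_obs_preimage iY mC.
have <- : wsum n (fun s => pr (obs X U n @^-1` C `&` word X s)) =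
  pr (obs X U n @^-1` C) by exact: wsum_prob_word.
have <- : wsum n (fun s => pr (obs Y V n @^-1` C `&` word Y s)) =
  pr (obs Y V n @^-1` C) by exact: wsum_prob_word.
rewrite -wsum_lin.
apply: le_wsum => s sn.
have := @prob_obs_word _ _ _ P p q X U Y V n s s C iX iY p01 q01.
rewrite sn => /(_ (leqnn _) (leqnn _) erefl mC).
rewrite -/(pr _) -/(pr _).
have wp := wt_gt0 s p01; have wq := wt_gt0 s q01.
set a := pr _; set b := pr _ => ab.
have -> : b = (wt q s / wt p s) * a.
  by rewrite mulrAC ab mulrAC divff ?mul1r// gt_eqF.
rewrite mulrA -mulrDl [leRHS]mulrC; apply: ler_wpM2l; first exact: fine_ge0.
rewrite /llr; set L := wt q s / wt p s.
have L0 : 0 < L by rewrite divr_gt0.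
have := @le_ln1Dx R (L / c - 1).
rewrite subrKC ltrBrDl subrr divr_gt0// => /(_ isT).
rewrite ln_div ?posrE//; lra.
Qed.

(** Summing [llr_step] gives Wald's identity for min(N, n), whose expectation is the sum on the
    left. The stopped terms are bounded by [llr_le] with a constant [c b] for each output, the
    surviving term with constant 1, which leaves the difference of the tails. *)
Lemma kl_stopped n (c : bool -> R) : (forall b, 0 < c b) ->
  - kl p q * \sum_(0 <= k < n) pr (N_gt tau X U k) <=
  \sum_(0 <= k < n)
    (((ln (c true) - 1) * pr (stopX true k) + (c true)^-1 * pr (stopY true k)) +
     ((ln (c false) - 1) * pr (stopX false k) + (c false)^-1 * pr (stopY false k)))
  + (pr (N_gt tau Y V n) - pr (N_gt tau X U n)).
Proof.
move=> c0.
have mF b k := measurable_fire b (n := k) mf.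
have step : - kl p q * \sum_(0 <= k < n) pr (N_gt tau X U k) =
    \sum_(0 <= k < n)
      (wsum k.+1 (fun s => pr (stopX true k `&` word X s) * llr s) +
       wsum k.+1 (fun s => pr (stopX false k `&` word X s) * llr s)) +
    wsum n (fun s => pr (N_gt tau X U n `&` word X s) * llr s).
  elim: n => [|n IH].
    by rewrite !big_geq//= /llr /wt !big_nil divr1 ln1 !mulr0 addr0.
  rewrite [in LHS]big_nat_recr//= mulrDr IH.
  rewrite -[LHS]addrA mulNr llr_step [in RHS]big_nat_recr//=.
  by rewrite -[RHS]addrA [in RHS](addrC (_ + _) (wsum _ _)).
rewrite step; apply: lerD.
  by apply: ler_sum => k _; apply: lerD; exact: llr_le.
rewrite !N_gtE; apply: le_trans (llr_le ltr01 (measurable_go_on (n := n) mf)) _.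
by rewrite ln1 sub0r invr1 !mulN1r mul1r addrC.
Qed.

End Divergence.

(** * Output law and expected stopping time *)

Section Output.
Context {R : realType} d (T : measurableType d) (P : probability T R).
Context (tau gamma : @stopfun R).
Arguments tau : clear implicits.
Arguments gamma : clear implicits.
Implicit Types (X : nat -> T -> bool) (U : nat -> T -> R).

(** The stopping events are disjoint over time and output and exhaust [N_finite]; almost sure
    termination thus leaves mass [1 - a] for output 0. *)
Lemma cvg_sum_stop p X U a : measurable_factory tau gamma ->
  iid_setting P p X U -> P (N_finite tau X U) = 1%E ->
  P (Y_one tau gamma X U) = a%:E ->
  \sum_(0 <= k < n) fine (P (stop tau gamma X U true k)) @[n --> \oo] --> a /\
  \sum_(0 <= k < n) fine (P (stop tau gamma X U false k)) @[n --> \oo] --> 1 - a.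
Proof.
move=> mf iX hN hY.
have mS b k := measurable_stop mf b k iX.
have tS b : trivIset setT (stop tau gamma X U b).
  by apply: ltn_trivIset => n m mn; exact: stop_disjoint.
have YE : Y_one tau gamma X U = \bigcup_k stop tau gamma X U true k.
  apply/seteqP; split=> t.
    by move=> [n [h1 h2 h3]]; exists n => //; rewrite stopE.
  by move=> [n _]; rewrite stopE => -[h1 h2 h3]; exists n.
have NE : N_finite tau X U = Y_one tau gamma X U `|` \bigcup_k stop tau gamma X U false k.
  rewrite YE; apply/seteqP; split=> t; last first.
    by move=> [[n _]|[n _]]; rewrite stopE => -[_ h _]; exists n.
  move=> [n0 hn0].
  have ex : exists n, tau n (obs X U n.+1 t) by exists n0.
  have hn := ex_minnP ex; case: hn => n taun nmin.
  have ng : N_gt tau X U n t.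
    move=> k kn; apply/negP => /nmin; by rewrite leqNgt kn.
  by case gn: (gamma n (obs X U n.+1 t)); [left|right]; exists n => //; rewrite stopE.
have dis : Y_one tau gamma X U `&` \bigcup_k stop tau gamma X U false k = set0.
  rewrite YE -subset0 => t [[m _ hm] [n _ hn]].
  case: (ltngtP m n) => mn.
  - by rewrite -(stop_disjoint tau gamma X U true false mn).
  - by rewrite -(stop_disjoint tau gamma X U false true mn).
  - by rewrite -(stop_labels_disjoint tau gamma X U n); split=> //; rewrite -mn.
have c b := @cvg_sum_fine_prob _ _ _ P _ (mS b) (tS b).
have aE : fine (P (\bigcup_k stop tau gamma X U true k)) = a by rewrite -YE hY.
split; first by rewrite -aE; exact: c.
suff -> : 1 - a = fine (P (\bigcup_k stop tau gamma X U false k)) by exact: c.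
have -> : 1 = fine (P (N_finite tau X U)) by rewrite hN.
rewrite NE fine_probU//; first by rewrite -YE in aE; rewrite aE addrAC subrr add0r.
  by rewrite YE; exact: bigcup_measurable.
exact: bigcup_measurable.
Qed.

(** Obtained from [kl_stopped] as [n] tends to infinity: the tails vanish and the stopped masses
    converge to the output laws. *)
Lemma kl_output_le p q X U Y V a b e :
  measurable_factory tau gamma -> iid_setting P p X U -> iid_setting P q Y V ->
  0 < p < 1 -> 0 < q < 1 -> 0 < a < 1 -> 0 < b < 1 ->
  P (N_finite tau X U) = 1%E -> P (Y_one tau gamma X U) = a%:E ->
  P (N_finite tau Y V) = 1%E -> P (Y_one tau gamma Y V) = b%:E ->
  (forall n, \sum_(0 <= k < n) fine (P (N_gt tau X U k)) <= e) ->
  kl a b <= e * kl p q.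
Proof.
move=> mf iX iY p01 q01 /andP[a0 a1] /andP[b0 b1] NX oX NY oY le_e.
have a1' : 0 < 1 - a by rewrite subr_gt0.
have b1' : 0 < 1 - b by rewrite subr_gt0.
(* Likelihood ratios of the output bit: with them [(ln (c true) - 1) * a + (c true)^-1 * b] reduces
   to [a * ln (b / a)], and similarly for output 0, so the limit is exactly [- kl a b]. *)
pose c (o : bool) := if o then b / a else (1 - b) / (1 - a).
have c0 o : 0 < c o by case: o; rewrite divr_gt0.
have [cXt cXf] := cvg_sum_stop mf iX NX oX.
have [cYt cYf] := cvg_sum_stop mf iY NY oY.
pose SX o n := \sum_(0 <= k < n) fine (P (stop tau gamma X U o k)).
pose SY o n := \sum_(0 <= k < n) fine (P (stop tau gamma Y V o k)).
(* The right-hand side of [kl_stopped], each tail being written as 1 minus the stopped mass; the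
   ones cancel. *)
pose r n := (ln (c true) - 1) * SX true n + (c true)^-1 * SY true n +
  ((ln (c false) - 1) * SX false n + (c false)^-1 * SY false n) +
  (SX true n + SX false n - (SY true n + SY false n)).
have r_ge n : - (e * kl p q) <= r n.
  have := @kl_stopped _ _ _ P tau gamma p q X Y U V mf iX iY p01 q01 n c c0.
  rewrite !(fine_prob_N_gt mf n iX) !(fine_prob_N_gt mf n iY).
  rewrite !big_split/= -!mulr_sumr => h.
  have {h} : - kl p q * (\sum_(0 <= k < n) fine (P (N_gt tau X U k))) <= r n.
    apply: le_trans h _; rewrite le_eqVlt; apply/orP; left; apply/eqP.
    rewrite /r /SX /SY; ring.
  apply: le_trans.
  by rewrite mulNr lerN2 mulrC ler_wpM2r// kl_ge0.
have cr : r n @[n --> \oo] -->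
    (ln (c true) - 1) * a + (c true)^-1 * b +
    ((ln (c false) - 1) * (1 - a) + (c false)^-1 * (1 - b)) +
    (a + (1 - a) - (b + (1 - b))).
  have cM (k l : R) (u : nat -> R) : u n @[n --> \oo] --> l -> k * u n @[n --> \oo] --> k * l.
    by move=> h; apply: cvgM => //; exact: cvg_cst.
  apply: cvgD; first by apply: cvgD; apply: cvgD; exact: cM.
  by apply: cvgB; exact: cvgD.
have : - (e * kl p q) <= - kl a b.
  suff -> : - kl a b = (ln (c true) - 1) * a + (c true)^-1 * b +
      ((ln (c false) - 1) * (1 - a) + (c false)^-1 * (1 - b)) +
      (a + (1 - a) - (b + (1 - b))).
    by apply: (cvgr_to_ge cr); exact: nearW.
  rewrite /kl /c; field.
  by rewrite !gt_eqF.
by rewrite lerN2.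
Qed.

(* No measurability is required: the integral of a nonnegative function is the
   supremum over the simple functions below it. *)
Lemma ge0_le_integral_sup (f g : T -> \bar R) :
  (forall t, (0 <= f t)%E) -> (forall t, (f t <= g t)%E) ->
  (\int[P]_t f t <= \int[P]_t g t)%E.
Proof.
move=> f0 fg; rewrite !ge0_integralTE//; last by move=> t; exact: le_trans (fg t).
by apply: ereal_sup_le => _ [h hf <-]; exists h => // t; exact: le_trans (fg t).
Qed.

Lemma sum_indic_le_stop_time X U n t :
  ((\sum_(0 <= k < n) \1_(N_gt tau X U k) t)%:E <= stop_time tau X U t)%E.
Proof.
apply: le_ereal_inf_tmp => _ [m /= taum <-]; rewrite lee_fin.
(* [stop_time] is an infimum over all firing indices, so the bound is shown for each [m]; the cap
   [minn n m.+1] carries the induction on [n]. *)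
apply: (@le_trans _ _ (minn n m.+1)%:R); last by rewrite ler_nat geq_minr.
elim: n => [|n IH]; first by rewrite big_geq// min0n.
rewrite big_nat_recr//=.
have [nm|mn] := leqP n m.
  rewrite (minn_idPl (leqW nm)) in IH; rewrite minnSS (minn_idPl nm).
  by rewrite -[n.+1%:R]natr1 lerD// indicE lern1 leq_b1.
rewrite indicE memNset ?addr0.
  by apply: le_trans IH _; rewrite ler_nat leq_min geq_minr andbT geq_min leqnSn.
by move=> /(_ m mn); rewrite taum.
Qed.

(** One half of the tail-sum formula: the sum is the expectation of min(N, n). *)
Lemma sum_N_gt_le_expectation X U n :
  (forall k, measurable (N_gt tau X U k)) ->
  (\sum_(0 <= k < n) P (N_gt tau X U k) <= \int[P]_t stop_time tau X U t)%E.
Proof.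
move=> mN.
apply: (@le_trans _ _ (\int[P]_t (\sum_(0 <= k < n) (\1_(N_gt tau X U k) t)%:E))%E).
  rewrite ge0_integral_sum//; last first.
    by move=> k; apply/measurable_EFinP; exact: measurable_indic.
  by apply: lee_sum => k _; rewrite integral_indic// setIT.
apply: ge0_le_integral_sup => t.
  by apply: sume_ge0 => k _; rewrite lee_fin.
by rewrite sumEFin; exact: sum_indic_le_stop_time.
Qed.

End Output.

(** * The information inequality for the expected stopping time *)

Theorem theorem3 (R : realType) (S : set R) (f : R -> R)
  (tau gamma : @stopfun R) :
  open S ->
  S `<=` `]0, 1[ ->
  (forall p, S p -> 0 < f p < 1) ->
  (forall p, S p -> derivable f p 1) ->
  bernoulli_factory S f tau gamma ->
  fast_factory S tau ->
  forall p, S p ->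
  forall d (T : measurableType d) (P : probability T R)
         (X : nat -> T -> bool) (U : nat -> T -> R),
    iid_setting P p X U ->
    (((derive1 f p) ^+ 2 * (p * (1 - p) / (f p * (1 - f p))))%:E
       <= \int[P]_t stop_time tau X U t)%E.
Proof.
move=> oS S01 f01 df [mf factory] _ p Sp d T P X U iX.
have S01' q : S q -> 0 < q < 1 by move=> /S01; rewrite /= in_itv.
have mN k : measurable (N_gt tau X U k) by exact: (measurable_N_gt mf k iX).
have sum_le n := sum_N_gt_le_expectation P n mN.
have E0 : (0 <= \int[P]_t stop_time tau X U t)%E.
  by have := sum_le 0%N; rewrite big_geq.
(* An infinite expectation makes the bound trivial; otherwise [e] is its real value. *)
case EN : (\int[P]_t stop_time tau X U t)%E E0 sum_le => [e| |] E0 sum_le; [|exact: leey|by []].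
move: E0; rewrite !lee_fin => e0.
have {}sum_le n : \sum_(0 <= k < n) fine (P (N_gt tau X U k)) <= e.
  by rewrite -lee_fin EFin_sum_fine// => k _; exact: fin_num_measure.
apply: (kl_le_cramer_rao (S01' _ Sp) (df _ Sp) (f01 _ Sp)) => //.
have Sp' : nbhs p S by exact: open_nbhs_nbhs.
apply: filterS Sp' => q Sq; split; [exact: S01'|exact: f01|].
(* The factory property holds on every probability space, hence for the relabelled experiment at [q]
   on [T]. *)
have iY := iid_setting_relabel (S01' _ Sq) iX.
have [NX oX] := factory _ Sp _ _ _ _ _ iX.
have [NY oY] := factory _ Sq _ _ _ _ _ iY.
exact: (kl_output_le mf iX iY (S01' _ Sp) (S01' _ Sq) (f01 _ Sp) (f01 _ Sq)
  NX oX NY oY sum_le).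
Qed.
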